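(* Let $G=(V,D,B)$ be a mixed graph, $v\in V$, $w_0\to v\in G$, and suppose the edges $w_1\to v,\dots,w_\ell\to v\in G$ (with $\ell\ge0$ and $w_0,\dots,w_\ell$ distinct) are generically (respectively, rationally) identifiable. Let $G^*_{\mathrm{flow}}$ be $G_{\mathrm{flow}}$ with the edges $w_0'\to v',\dots,w_\ell'\to v'$ removed. Suppose there are sets $S\subset V$ and $T\subset V\setminus\{v,w_0\}$ with $|S|=|T|+1=k$ such that: (a) $\mathrm{des}(v)\cap(T\cup\{v\})=\emptyset$; (b) the maximum flow from $S$ to $T'\cup\{w_0'\}$ in $G_{\mathrm{flow}}$ equals $k$; (c) the maximum flow from $S$ to $T'\cup\{v'\}$ in $G^*_{\mathrm{flow}}$ is less than $k$. Then $w_0\to v$ is generically (respectively, rationally) identifiable, by the equation $$\lambda_{w_0v}=\frac{|\Sigma_{S,T\cup\{v\}}|-\sum_{i=1}^{\ell}\lambda_{w_iv}|\Sigma_{S,T\cup\{w_i\}}|}{|\Sigma_{S,T\cup\{w_0\}}|},$$ where $\Sigma=\phi_G(\Lambda,\Omega)$ and $|\cdot|$ denotes the determinant (rows and columns ordered compatibly).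
   Context: A mixed graph $G=(V,D,B)$ on $V=\{1,\dots,n\}$ has directed edges $D\subset V\times V$ ($v\to w\in G$ iff $(v,w)\in D$) and symmetric bidirected edges $B$ ($v\leftrightarrow w\in G$ iff $(v,w)\in B$), no self-loops. $\mathrm{des}(v)$ is the set of $w$ such that there is a non-empty directed path from $v$ to $w$. $\mathbb{R}^D_{\mathrm{reg}}$ is the set of real $n\times n$ matrices $\Lambda$ supported on $D$ with $I-\Lambda$ invertible; $PD(B)$ is the set of positive definite $\Omega$ with $\omega_{vw}=0$ for $v\ne w$ unless $v\leftrightarrow w\in G$. $\Theta=\mathbb{R}^D_{\mathrm{reg}}\times PD(B)$, $\phi_G(\Lambda,\Omega)=(I-\Lambda)^{-T}\Omega(I-\Lambda)^{-1}$. An edge $u\to w$ is generically identifiable if there is a proper algebraic subset $A\subset\Theta$ such that for all $(\Lambda,\Omega)\in\Theta\setminus A$, every $(\tilde\Lambda,\tilde\Omega)\in\Theta$ with $\phi_G(\tilde\Lambda,\tilde\Omega)=\phi_G(\Lambda,\Omega)$ has $\tilde\lambda_{uw}=\lambda_{uw}$; rationally identifiable if there is a rational function $\psi$ and proper algebraic $A\subset\Theta$ with $\psi(\phi_G(\Lambda,\Omega))=\lambda_{uw}$ on $\Theta\setminus A$. $G_{\mathrm{flow}}$ is the directed graph on $\{1,\dots,n\}\cup\{1',\dots,n'\}$ with edges $i\to j$ whenever $j\to i\in G$, $i\to i'$ for all $i$, $i\to j'$ whenever $i\leftrightarrow j\in G$, and $i'\to j'$ whenever $i\to j\in G$, all vertices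 and edges of capacity $1$; $T'=\{t':t\in T\}$. Maximum flows allow multiple sources/sinks and vertex capacities. *)

(* Defs.v *)
From HB Require Import structures.
From mathcomp Require Import all_boot all_order all_algebra.
From mathcomp Require Import reals.
Set Implicit Arguments. Unset Strict Implicit. Unset Printing Implicit Defensive.
Import Order.TTheory GRing.Theory Num.Theory.
Local Open Scope ring_scope.

Inductive polyfun (R : ringType) (I X : Type) (c : I -> X -> R) : (X -> R) -> Prop :=
| pf_const (a : R) : polyfun c (fun _ => a)
| pf_coord (i : I) : polyfun c (c i)
| pf_add f g : polyfun c f -> polyfun c g -> polyfun c (fun x => f x + g x)
| pf_mul f g : polyfun c f -> polyfun c g -> polyfun c (fun x => f x * g x)
| pf_ext f g : (forall x, f x = g x) -> polyfun c f -> polyfun c g.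

(* A mixed graph on 'I_n: directed edges D (v -> w iff D v w),
   bidirected edges B (symmetric); no self-loops. *)
Definition mixed_graph (n : nat) (D B : rel 'I_n) : Prop :=
  (forall v, ~~ D v v) /\ (forall v, ~~ B v v) /\ (forall v w, B v w = B w v).

Definition des (n : nat) (D : rel 'I_n) (v w : 'I_n) : Prop :=
  exists u, D v u /\ connect D u w.

Section Params.
Variables (R : realType) (n : nat) (D B : rel 'I_n).

Definition param := ('M[R]_n * 'M[R]_n)%type.

Definition Lambda_reg (L : 'M[R]_n) : Prop :=
  (forall i j, ~~ D i j -> L i j = 0) /\ (1%:M - L) \in unitmx.

Definition PD_B (O : 'M[R]_n) : Prop :=
  O^T = O /\ (forall x : 'rV[R]_n, x != 0 -> 0 < (x *m O *m x^T) 0 0) /\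
  (forall i j, i != j -> ~~ B i j -> O i j = 0).

Definition Theta (th : param) : Prop := Lambda_reg th.1 /\ PD_B th.2.

Definition phiG (th : param) : 'M[R]_n :=
  (invmx (1%:M - th.1))^T *m th.2 *m invmx (1%:M - th.1).

Definition param_coord (i : bool * 'I_n * 'I_n) (th : param) : R :=
  let: (b, a, c) := i in if b then th.1 a c else th.2 a c.

Definition mx_coord (i : 'I_n * 'I_n) (S : 'M[R]_n) : R := S i.1 i.2.

Definition proper_algebraic_subset (A : param -> Prop) : Prop :=
  (exists (m : nat) (ps : 'I_m -> param -> R),
      (forall k, polyfun param_coord (ps k)) /\
      (forall th, A th <-> (Theta th /\ forall k, ps k th = 0)))
  /\ exists th, Theta th /\ ~ A th.

Definition generically_identifiable (u w : 'I_n) : Prop :=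
  exists A, proper_algebraic_subset A /\
    forall th, Theta th -> ~ A th ->
      forall th', Theta th' -> phiG th' = phiG th -> th'.1 u w = th.1 u w.

Definition rationally_identifiable (u w : 'I_n) : Prop :=
  exists (P Q : 'M[R]_n -> R),
    polyfun mx_coord P /\ polyfun mx_coord Q /\
    exists A, proper_algebraic_subset A /\
      forall th, Theta th -> ~ A th ->
        Q (phiG th) != 0 /\ P (phiG th) / Q (phiG th) = th.1 u w.
End Params.

(* vertices of G_flow: inl i = i, inr i = i' *)
Definition flow_edge (n : nat) (D B : rel 'I_n) : rel ('I_n + 'I_n) :=
  fun x y => match x, y with
  | inl i, inl j => D j i
  | inl i, inr j => (i == j) || B i j
  | inr i, inr j => D i j
  | inr _, inl _ => false
  end.

Definition flow_edge_del (n : nat) (D B : rel 'I_n) (W : seq 'I_n) (v : 'I_n)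
  : rel ('I_n + 'I_n) :=
  fun x y => flow_edge D B x y && ~~ ((x \in [seq inr w | w <- W]) && (y == inr v)).

Section Flows.
Variables (R : realType) (V : finType) (E : rel V) (Src Snk : {set V}).

Definition inflow (f : V -> V -> R) (x : V) : R := \sum_(y : V) f y x.
Definition outflow (f : V -> V -> R) (x : V) : R := \sum_(y : V) f x y.

(* feasible flow from sources Src to sinks Snk; all vertices and edges of
   capacity 1; sources/sinks are attached to a super-source/super-sink *)
Definition is_flow (f : V -> V -> R) : Prop :=
  (forall x y, 0 <= f x y <= 1) /\
  (forall x y, ~~ E x y -> f x y = 0) /\
  (forall x, inflow f x <= 1 /\ outflow f x <= 1) /\
  (forall x, x \notin Src -> x \notin Snk -> inflow f x = outflow f x) /\
  (forall x, x \in Src -> x \notin Snk -> inflow f x <= outflow f x) /\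
  (forall x, x \in Snk -> x \notin Src -> outflow f x <= inflow f x).

Definition flow_value (f : V -> V -> R) : R :=
  \sum_(t in Snk) (inflow f t - outflow f t).

Definition maxflow_eq (k : nat) : Prop :=
  (exists f, is_flow f /\ flow_value f = k%:R) /\
  (forall f, is_flow f -> flow_value f <= k%:R).

Definition maxflow_lt (k : nat) : Prop :=
  forall f, is_flow f -> flow_value f < k%:R.
End Flows.

Definition minor (R : comRingType) (n : nat) (d : 'I_n) (M : 'M[R]_n)
  (rs cs : seq 'I_n) : R :=
  \det (\matrix_(i < size rs, j < size rs) M (nth d rs i) (nth d cs j)).

(* Main.v *)
Require Import Defs.
From HB Require Import structures.
From mathcomp Require Import all_boot all_order all_algebra.
From mathcomp Require Import reals.
From mathcomp Require Import perm ring.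
Import Order.TTheory GRing.Theory Num.Theory.
Local Open Scope ring_scope.

Set Implicit Arguments. Unset Strict Implicit. Unset Printing Implicit Defensive.

(* Put N = [[L^T, O], [0, L]], a weighted adjacency matrix of G_flow. Sigma is the
   upper right block of (1 - N)^-1, so up to sign a minor Sigma_{S,Y} is
   det (1 - N)^-1 times the determinant of 1 - N bordered by the unit columns of Y'
   and the unit rows of S.

   A nonzero term of the Leibniz expansion of the bordered determinant is a
   bijection from the vertices outside Y' to the vertices outside S along edges or
   loops, i.e. a 0/1 flow of value k from S to Y'. By (a), the combination
   |Sigma_{S,T+v}| - sum_{i >= 0} lambda_{w_i v} |Sigma_{S,T+w_i}| is such a minor for
   G*_flow, so by (c) it vanishes at every point of Theta.

   Conversely, by Hall's theorem a fractional flow of value k yields such a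
   bijection. It splits into a left part, a right part and k crossings i -> j'. With
   one row of a k x n matrix Gamma per crossing, supported on {i, j}, and
   O = Gamma^T Gamma, the minor factors as a left determinant times a right one;
   each of them is nonzero somewhere, hence both are nonzero at a generic point. So
   (b) makes |Sigma_{S,T+w_0}| generically nonzero. *)

(** * Bipartite matchings and flows *)

(** Induction on [#|A|]. A tight proper subset [Z] is matched first and the rest outside its
    neighbours; if there is none, any [a] may take any neighbour [b]. [u0] is a default value, as
    [h] is total. *)
Lemma hall (T U : finType) (u0 : U) (N : T -> {set U}) (A : {set T}) :
  (forall Z : {set T}, Z \subset A -> (#|Z| <= #|\bigcup_(x in Z) N x|)%N) ->
  exists h : T -> U,
    {in A &, injective h} /\ forall x, x \in A -> h x \in N x.
Proof.
have [m] := ubnP #|A|; elim: m => // m IHm in N A * => /ltnSE leAm hallA.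
have [->|/set0Pn[a aA]] := eqVneq A set0.
  by exists (fun=> u0); split=> x; rewrite inE.
pose NN (W : {set T}) := \bigcup_(x in W) N x.
have NND (C : {set U}) (W : {set T}) : \bigcup_(x in W) (N x :\: C) = NN W :\: C.
  apply/setP=> u; rewrite inE; apply/bigcupP/andP.
    by case=> x xW; rewrite inE => /andP[? ?]; split=> //; apply/bigcupP; exists x.
  by case=> uC /bigcupP[x xW ux]; exists x => //; rewrite inE uC.
have [/existsP[Z /and3P[Z0 ZA /eqP tightZ]]|/existsPn loose] :=
  boolP [exists Z : {set T}, [&& Z != set0, Z \proper A & #|NN Z| == #|Z|]].
  have [h1 [h1inj h1N]] : exists h : T -> U,
      {in Z &, injective h} /\ forall x, x \in Z -> h x \in N x.
    apply: IHm => [|W WZ]; first exact: leq_trans (proper_card ZA) leAm.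
    by apply: hallA; apply: subset_trans WZ (proper_sub ZA).
  have [h2 [h2inj h2N]] : exists h : T -> U,
      {in A :\: Z &, injective h} /\
      forall x, x \in A :\: Z -> h x \in N x :\: NN Z.
    apply: IHm => [|W].
      apply: leq_trans leAm; apply: proper_card.
      apply/properP; split; first exact: subsetDl.
      have /set0Pn[z zZ] := Z0.
      by exists z; rewrite ?inE ?zZ // (subsetP (proper_sub ZA)).
    rewrite subsetD => /andP[WA WZ]; rewrite NND cardsD.
    (* Hall's condition for [W :|: Z], after cancelling the tight [Z], is the one for [W] outside
       [NN Z]. *)
    have /hallA : W :|: Z \subset A by rewrite subUset WA proper_sub.
    rewrite bigcup_setU -/(NN W) -/(NN Z) cardsU cardsU tightZ.
    rewrite disjoint_setI0 // cards0 subn0 => leU.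
    rewrite -(leq_add2r #|Z|); apply: leq_trans leU _.
    by rewrite -addnBAC ?subset_leq_card ?subsetIl.
  exists (fun x => if x \in Z then h1 x else h2 x); split=> [x y xA yA|x xA].
    have out z w : z \in Z -> w \in A -> w \notin Z -> h1 z = h2 w -> False.
      move=> zZ wA wZ eqh; have /h2N : w \in A :\: Z by rewrite inE wZ.
      by rewrite inE -eqh => /andP[/negP[]]; apply/bigcupP; exists z; rewrite ?h1N.
    case: ifPn => xZ; case: ifPn => yZ eqh.
    - exact: h1inj.
    - by case: (out x y).
    - by case: (out y x).
    - by apply: h2inj; rewrite ?inE ?xZ ?yZ.
  case: ifPn => xZ; first exact: h1N.
  by have /h2N : x \in A :\: Z by [rewrite inE xZ]; rewrite inE => /andP[].
have /card_gt0P[b bNa] : (0 < #|N a|)%N.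
  by have := hallA [set a]; rewrite big_set1 cards1 sub1set; apply.
have [h [hinj hN]] : exists h : T -> U,
    {in A :\ a &, injective h} /\ forall x, x \in A :\ a -> h x \in N x :\: [set b].
  apply: IHm => [|W WA].
    by apply: leq_trans leAm; rewrite [X in (_ < X)%N](cardsD1 a) aA.
  rewrite NND; have [->|W0] := eqVneq W set0; first by rewrite cards0.
  have WpA : W \proper A.
    by apply: sub_proper_trans WA _; rewrite properD1.
  have := loose W; rewrite W0 WpA /= => ne.
  (* With no tight proper subset, [W] has a neighbour to spare, which pays for [b]. *)
  have : (#|W| < #|NN W|)%N.
    by rewrite ltn_neqAle eq_sym ne; apply/hallA/proper_sub.
  by rewrite (cardsD1 b) => ltW; rewrite -ltnS (leq_trans ltW) // -add1n leq_add2r leq_b1.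
exists (fun x => if x == a then b else h x); split=> [x y xA yA|x xA].
  have out z : z \in A -> z != a -> h z = b -> False.
    move=> zA za eqh; have /hN : z \in A :\ a by rewrite !inE za.
    by rewrite eqh !inE eqxx.
  case: eqVneq => [->|xa]; case: eqVneq => [->|ya] // eqh.
  - by case: (out y).
  - by case: (out x).
  - by apply: hinj; rewrite ?inE ?xa ?ya.
case: eqVneq => [->|xa] //.
by have /hN : x \in A :\ a by [rewrite !inE xa]; rewrite inE => /andP[].
Qed.

Section Flow.
Variables (R : realType) (V : finType) (E : rel V) (Src Snk : {set V}).
Hypothesis dis : [disjoint Src & Snk].

Lemma flow_of_linking (g : V -> option V) :
  (forall x, (x \in Snk) = (g x == None)) ->
  (forall x x' y, g x = Some y -> g x' = Some y -> x = x') ->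
  (forall y, y \notin Src -> exists x, g x = Some y) ->
  (forall x y, g x = Some y -> (x == y) || E x y) ->
  exists f : V -> V -> R, is_flow E Src Snk f /\ flow_value Snk f = #|Snk|%:R.
Proof.
move=> gN ginj gsurj gE.
pose f x y : R := ((x != y) && (g x == Some y))%:R.
have outE x : outflow f x = ((g x != None) && (g x != Some x))%:R.
  rewrite /outflow /f; case gx: (g x) => [y|]; last first.
    by rewrite big1 // => y _; rewrite andbF.
  rewrite (bigD1 y) //= eqxx andbT big1 ?addr0 => [|z zy]; last first.
    by rewrite (inj_eq Some_inj) [y == z]eq_sym (negPf zy) andbF.
  by rewrite (inj_eq Some_inj) eq_sym.
have inE_ y x : g x = Some y -> inflow f y = (x != y)%:R.
  move=> gx; rewrite /inflow /f (bigD1 x) //= gx eqxx andbT big1 ?addr0 // => z zx.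
  rewrite [g z == _](_ : _ = false) ?andbF //; apply/eqP=> gz.
  by rewrite (ginj _ _ _ gz gx) eqxx in zx.
have in0 y : (forall x, g x != Some y) -> inflow f y = 0.
  by move=> ng; rewrite /inflow big1 // => x _; rewrite /f (negPf (ng x)) andbF.
have inP y : (exists x, g x = Some y) \/ (forall x, g x != Some y).
  have [/existsP[x /eqP gx]|/existsPn ng] := boolP [exists x, g x == Some y].
    by left; exists x.
  by right.
have in01 y : inflow f y <= 1.
  by case: (inP y) => [[x /inE_ ->]|/in0 ->] //; rewrite ?lern1 ?leq_b1 ?ler01.
have inle y : y \notin Snk -> inflow f y <= outflow f y.
  rewrite gN outE => ->; case: (inP y) => [[x gx]|ng]; last first.
    by rewrite in0 // ng ler01.
  rewrite (inE_ _ _ gx) ler_nat; case: eqVneq => //= xy.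
  by case: eqP => // /ginj/(_ gx) yx; rewrite yx eqxx in xy.
have outle y : y \notin Src -> outflow f y <= inflow f y.
  case/gsurj=> x gx; rewrite (inE_ _ _ gx) outE ler_nat.
  case: (eqVneq x y) => [xy|_]; last exact: leq_b1.
  by rewrite xy in gx; rewrite gx eqxx andbF.
exists f; split.
  split=> [x y|]; first by rewrite /f ler0n lern1 leq_b1.
  split=> [x y nE|].
    rewrite /f; case: eqVneq => //= xy; case: eqP => // /gE.
    by rewrite (negPf xy) (negPf nE).
  split=> [x|]; first by rewrite in01 outE lern1 leq_b1.
  split=> [x xS xT|]; first by apply/le_anti; rewrite inle ?outle.
  by split=> x xS xT; [apply: inle|apply: outle].
rewrite /flow_value (eq_bigr (fun=> 1)) ?sumr_const // => t tS.
have tN : t \notin Src by apply: contraL tS => /(disjointFr dis) ->.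
have [x gx] := gsurj t tN.
move: (tS); rewrite gN => /eqP gt.
rewrite (inE_ _ _ gx) outE gt subr0; case: eqP => // xt.
by rewrite xt gt in gx.
Qed.

Lemma linking_of_flow (f : V -> V -> R) :
  #|Src| = #|Snk| -> is_flow E Src Snk f -> flow_value Snk f = #|Snk|%:R ->
  exists g : V -> option V,
   [/\ forall x, (x \in Snk) = (g x == None),
       forall x x' y, g x = Some y -> g x' = Some y -> x = x',
       forall y, y \notin Src -> exists x, g x = Some y,
       forall x y, g x = Some y -> y \notin Src &
       forall x y, g x = Some y -> (x == y) || E x y].
Proof.
move=> cST [f01 [fE [cap [bal [balS balT]]]]] val.
have f0 x y : 0 <= f x y by case/andP: (f01 x y).
have in0 x : 0 <= inflow f x by apply: sumr_ge0.
have sum0 : \sum_x (outflow f x - inflow f x) = 0.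
  by rewrite sumrB /outflow /inflow exchange_big subrr.
have sumS : \sum_(x in Src) (outflow f x - inflow f x) = #|Snk|%:R.
  rewrite -val /flow_value; apply/eqP; rewrite -subr_eq0 -sumrN; apply/eqP.
  rewrite -[RHS]sum0 [RHS](bigID (mem Src)) /=; congr (_ + _).
  rewrite [RHS](bigID (mem Snk)) /= [X in _ = _ + X]big1 ?addr0 => [|x]; last first.
    by case/andP=> xS xT; rewrite bal ?subrr.
  apply: eq_big => [x|x _]; last by rewrite opprB.
  by case xT: (x \in Snk); rewrite ?andbF // (disjointFl dis xT).
(* Each source has net outflow at most 1 and the total is [#|Src|], so all these bounds are
   tight. *)
have srcE x : x \in Src -> inflow f x = 0 /\ outflow f x = 1.
  move=> xS; have [_ capo] := cap x.
  have gap0 : \sum_(x in Src) (1 - (outflow f x - inflow f x)) = 0.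
    by rewrite sumrB sumS sumr_const cST subrr.
  have gap y : y \in Src -> 0 <= 1 - (outflow f y - inflow f y).
    move=> _; rewrite subr_ge0 lerBlDr; have [_ /le_trans->] // := cap y.
    by rewrite lerDl.
  have /eqP := psumr_eq0P gap gap0 xS; rewrite subr_eq0 => /eqP e.
  have i0 : inflow f x = 0.
    apply/le_anti; rewrite in0 andbT -(lerD2l 1).
    by rewrite {1}e subrK addr0.
  by split=> //; rewrite e i0 subr0.
have fS x y : y \in Src -> f x y = 0.
  move=> /srcE[i0 _]; exact: (psumr_eq0P (P := xpredT) (fun z _ => f0 z y) i0 isT).
(* The flow, completed on the diagonal so that the rows outside [Snk] sum to [1]
   over the columns outside [Src], and the columns to at most [1]. *)
pose M x y := f x y + (x == y)%:R * (1 - outflow f x).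
have M0 x y : 0 <= M x y.
  by rewrite addr_ge0 // mulr_ge0 ?ler0n // subr_ge0; case: (cap x).
pose N x := [set y | (y \notin Src) && ((x == y) || E x y)].
have rowM x (C : {set V}) : N x \subset C -> x \notin Snk ->
    1 <= \sum_(y in C) M x y.
  move=> NC xT.
  have le1 : \sum_(y in N x) M x y <= \sum_(y in C) M x y.
    rewrite [X in _ <= X](big_setID (N x)) /= (setIidPr NC) lerDl.
    exact: sumr_ge0.
  apply: le_trans le1.
  have -> : \sum_(y in N x) M x y = \sum_(y | y \notin Src) M x y.
    rewrite [RHS](bigID (fun y => (x == y) || E x y)) /=.
    rewrite [X in _ = _ + X]big1 ?addr0 => [|y].
      by apply: eq_bigl => y; rewrite inE.
    case/andP=> _; rewrite negb_or => /andP[xy nE].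
    by rewrite /M fE // (negPf xy) mul0r addr0.
  rewrite big_split /=.
  have -> : \sum_(y | y \notin Src) f x y = outflow f x.
    rewrite /outflow [RHS](bigID (mem Src)) /= [X in _ = X + _]big1 ?add0r // => y.
    exact: fS.
  case xS: (x \in Src).
    by have [_ ->] := srcE x xS; rewrite lerDl sumr_ge0 // => y _; rewrite subrr mulr0.
  rewrite (bigD1 x) ?xS //= eqxx mul1r addrA addrC big1 ?addr0 ?add0r; last first.
    by move=> y /andP[_ yx]; rewrite eq_sym (negPf yx) mul0r.
  by rewrite addrC subrK.
have colM y (Z : {set V}) : y \notin Src -> Z \subset ~: Snk ->
    \sum_(x in Z) M x y <= 1.
  move=> yS ZT.
  have le1 : \sum_(x in Z) f x y <= inflow f y.
    rewrite /inflow [X in _ <= X](bigID (mem Z)) /= lerDl.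
    exact: sumr_ge0.
  (* The diagonal counts only for [y] in [Z]; such a [y] is neither source nor sink, and
     conservation makes inflow plus [1 - outflow] equal to 1. *)
  rewrite big_split /=; case yZ: (y \in Z); last first.
    rewrite [X in _ + X]big1 ?addr0 => [|x xZ].
      by apply: le_trans le1 _; case: (cap y).
    by case: eqP => [xy|]; rewrite ?mul0r // -xy xZ in yZ *.
  rewrite [X in _ + X](bigD1 y) //= eqxx mul1r [X in _ + (_ + X)]big1 ?addr0; last first.
    by move=> x /andP[_ /negPf->]; rewrite mul0r.
  have yT : y \notin Snk by have := subsetP ZT _ yZ; rewrite inE.
  by rewrite -(bal y) // -lerBrDr subKr.
have [s0 _|V0] := pickP V; last by exists Some; split=> x; have := V0 x.
have [h [hinj hN]] : exists h : V -> V,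
    {in ~: Snk &, injective h} /\ forall x, x \in ~: Snk -> h x \in N x.
  (* The mass of [M] on [Z] times [C] is at least [#|Z|] by rows and at most [#|C|] by columns. *)
  apply: (hall s0) => Z ZT; rewrite -(ler_nat R) -!sumr_const.
  set C := \bigcup_(x in Z) N x.
  apply: le_trans (_ : \sum_(x in Z) \sum_(y in C) M x y <= _).
    apply: ler_sum => x xZ; apply: rowM; last by have := subsetP ZT _ xZ; rewrite inE.
    exact: bigcup_sup.
  rewrite exchange_big; apply: ler_sum => y /bigcupP[x xZ].
  by rewrite inE => /andP[yS _]; apply: colM.
exists (fun x => if x \in Snk then None else Some (h x)); split.
- by move=> x; case: ifP.
- move=> x x' y; do 2![case: ifPn => // ?]; move=> [<-] [eqh].
  by apply: hinj; rewrite ?inE.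
- have imh : h @: (~: Snk) = ~: Src.
    apply/eqP; rewrite eqEcard card_in_imset // -(leq_add2l #|Snk|).
    rewrite cardsC -cST cardsC leqnn andbT.
    by apply/subsetP=> _ /imsetP[x /hN + ->]; rewrite !inE => /andP[].
  move=> y yS; have : y \in h @: (~: Snk) by rewrite imh inE.
  by case/imsetP=> x; rewrite inE => /negPf xT ->; exists x; rewrite xT.
- move=> x y; case: ifPn => // xT [<-].
  by have := hN x; rewrite !inE xT => /(_ isT)/andP[].
- move=> x y; case: ifPn => // xT [<-].
  by have := hN x; rewrite !inE xT => /(_ isT)/andP[].
Qed.

End Flow.

(** * Polynomial functions and bordered determinants *)

Section PolyFun.
Variables (R : comNzRingType) (I X : Type) (c : I -> X -> R).

Lemma pf_opp f : polyfun c f -> polyfun c (fun x => - f x).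
Proof.
by move=> pf; apply: pf_ext (pf_mul (pf_const c (-1)) pf) => x; rewrite mulN1r.
Qed.

Lemma pf_sum (J : Type) (r : seq J) (P : pred J) (F : J -> X -> R) :
  (forall j, polyfun c (F j)) -> polyfun c (fun x => \sum_(j <- r | P j) F j x).
Proof.
move=> pF; elim: r => [|j r IHr].
  by apply: pf_ext (pf_const c 0) => x; rewrite big_nil.
case Pj: (P j).
  by apply: pf_ext (pf_add (pF j) IHr) => x; rewrite big_cons Pj.
by apply: pf_ext IHr => x; rewrite big_cons Pj.
Qed.

Lemma pf_prod (J : Type) (r : seq J) (P : pred J) (F : J -> X -> R) :
  (forall j, polyfun c (F j)) -> polyfun c (fun x => \prod_(j <- r | P j) F j x).
Proof.
move=> pF; elim: r => [|j r IHr].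
  by apply: pf_ext (pf_const c 1) => x; rewrite big_nil.
case Pj: (P j).
  by apply: pf_ext (pf_mul (pF j) IHr) => x; rewrite big_cons Pj.
by apply: pf_ext IHr => x; rewrite big_cons Pj.
Qed.

Lemma pf_det m (M : X -> 'M[R]_m) :
  (forall i j, polyfun c (fun x => M x i j)) -> polyfun c (fun x => \det (M x)).
Proof.
move=> pM; apply: pf_sum => s; apply: pf_mul; first exact: pf_const.
exact: pf_prod.
Qed.

Definition pfmx m p (M : X -> 'M[R]_(m, p)) :=
  forall i j, polyfun c (fun x => M x i j).

Lemma pfmx_const m p (A : 'M[R]_(m, p)) : pfmx (fun=> A).
Proof. by move=> i j; apply: pf_const. Qed.

Lemma pfmx_add m p (M N : X -> 'M[R]_(m, p)) :
  pfmx M -> pfmx N -> pfmx (fun x => M x + N x).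
Proof.
by move=> pM pN i j; apply: pf_ext (pf_add (pM i j) (pN i j)) => x; rewrite mxE.
Qed.

Lemma pfmx_opp m p (M : X -> 'M[R]_(m, p)) : pfmx M -> pfmx (fun x => - M x).
Proof. by move=> pM i j; apply: pf_ext (pf_opp (pM i j)) => x; rewrite mxE. Qed.

Lemma pfmx_tr m p (M : X -> 'M[R]_(m, p)) : pfmx M -> pfmx (fun x => (M x)^T).
Proof. by move=> pM i j; apply: pf_ext (pM j i) => x; rewrite mxE. Qed.

Lemma pfmx_block m1 m2 p1 p2 (M1 : X -> 'M[R]_(m1, p1)) (M2 : X -> 'M[R]_(m1, p2))
    (M3 : X -> 'M[R]_(m2, p1)) (M4 : X -> 'M[R]_(m2, p2)) :
  pfmx M1 -> pfmx M2 -> pfmx M3 -> pfmx M4 ->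
  pfmx (fun x => block_mx (M1 x) (M2 x) (M3 x) (M4 x)).
Proof.
move=> p1M p2M p3M p4M i j; case: (split_ordP i) => i' ->; case: (split_ordP j) => j' ->.
- by apply: pf_ext (p1M i' j') => x; rewrite block_mxEul.
- by apply: pf_ext (p2M i' j') => x; rewrite block_mxEur.
- by apply: pf_ext (p3M i' j') => x; rewrite block_mxEdl.
- by apply: pf_ext (p4M i' j') => x; rewrite block_mxEdr.
Qed.

End PolyFun.

(** * Polynomial functions along lines *)

Lemma poly_nonroot01 (R : realType) (p : {poly R}) :
  p != 0 -> exists t, 0 < t < 1 /\ p.[t] != 0.
Proof.
(* [size p] distinct points of the open unit interval, too many to be all roots. *)
move=> p0; pose s : seq R := [seq (i.+2%:R)^-1 | i <- iota 0 (size p)].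
have [/allP sp|/allPn[t]] := boolP (all (root p) s); last first.
  case/mapP=> i _ ->; rewrite rootE => pt; exists (i.+2%:R)^-1; split=> //.
  by rewrite invr_gt0 ltr0n /= invf_lt1 ?ltr0n // ltr1n.
have us : uniq s.
  rewrite map_inj_uniq ?iota_uniq // => i j /invr_inj/eqP.
  by rewrite eqr_nat => /eqP[].
have := max_poly_roots p0 (introT allP sp) us.
by rewrite size_map size_iota ltnn.
Qed.

Section Lines.
Variables (R : realType) (I X : Type) (c : I -> X -> R).
Variable line : R -> X -> X -> X.
Hypothesis lineE : forall t x y i, c i (line t x y) = (1 - t) * c i x + t * c i y.

Lemma polyfun_line f : polyfun c f -> forall x y,
  exists p : {poly R}, [/\ forall t, f (line t x y) = p.[t], p.[0] = f x & p.[1] = f y].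
Proof.
(* The claim is strengthened to every [z] with the right coordinates, so that the endpoints [x] and
   [y] are covered without being values of [line]. *)
move=> pf; suff H x y : exists p : {poly R}, forall t z,
    (forall i, c i z = (1 - t) * c i x + t * c i y) -> f z = p.[t].
  move=> x y; have [p pE] := H x y; exists p; split.
  - by move=> t; apply: pE.
  - by rewrite -(pE 0 x) // => i; rewrite subr0 mul1r mul0r addr0.
  - by rewrite -(pE 1 y) // => i; rewrite subrr mul1r mul0r add0r.
elim: pf => [a|i|{}f g _ [p pE] _ [q qE]|{}f g _ [p pE] _ [q qE]|{}f g fg _ [p pE]].
- by exists a%:P => t z _; rewrite hornerC.
- exists ((1 - 'X) * (c i x)%:P + 'X * (c i y)%:P) => t z ->.
  by rewrite !hornerE.
- by exists (p + q) => t z h; rewrite hornerD -(pE t z h) -(qE t z h).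
- by exists (p * q) => t z h; rewrite hornerM -(pE t z h) -(qE t z h).
- by exists p => t z h; rewrite -fg; apply: pE.
Qed.

(** On the line from [x] to [y] both functions become nonzero univariate polynomials, and so does
    their product. This takes the place of irreducibility of the parameter space. *)
Lemma polyfun_common_nonzero f g x y : polyfun c f -> polyfun c g ->
  f x != 0 -> g y != 0 ->
  exists t, [/\ 0 < t < 1, f (line t x y) != 0 & g (line t x y) != 0].
Proof.
move=> /polyfun_line/(_ x y)[p [pE p0 _]] /polyfun_line/(_ x y)[q [qE _ q1]] fx gy.
have pn0 : p != 0 by apply: contraNneq fx => p00; rewrite -p0 p00 horner0.
have qn0 : q != 0 by apply: contraNneq gy => q00; rewrite -q1 q00 horner0.
have [|t [t01]] := @poly_nonroot01 R (p * q); first by rewrite mulf_neq0.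
by rewrite hornerM mulf_eq0 negb_or => /andP[pt qt]; exists t; rewrite pE qE.
Qed.
End Lines.

Section Bordered.
Variable F : fieldType.

(** Block elimination: the Schur complement of [N] is [- (G *m N' *m E)]. *)
Lemma det_bordered m k (N N' : 'M[F]_m) (E : 'M_(m, k)) (G : 'M_(k, m)) :
  N *m N' = 1%:M ->
  \det (block_mx N E G 0) = \det N * ((-1) ^+ k * \det (G *m N' *m E)).
Proof.
move=> NN'; have N'N := mulmx1C NN'.
have -> : block_mx N E G 0 =
    block_mx N 0 G (- (G *m N' *m E)) *m block_mx 1%:M (N' *m E) 0 1%:M.
  rewrite mulmx_block !mulmx1 !mulmx0 !addr0 mulmxA NN' mul1mx.
  by rewrite mulmxA subrr.
by rewrite det_mulmx det_lblock det_ublock !det1 !mulr1 -scaleN1r detZ.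
Qed.

Lemma det_partial_perm_neq0 m (c : 'I_m -> 'I_m) : injective c ->
  \det (\matrix_(i, j) (c i == j)%:R : 'M[F]_m) != 0.
Proof.
move=> cinj; rewrite (_ : \matrix_(i, j) _ = perm_mx (perm cinj)).
  by rewrite det_perm signr_eq0.
by apply/matrixP=> i j; rewrite !mxE permE.
Qed.

Lemma det_neq0_perm m (M : 'M[F]_m) : \det M != 0 ->
  exists s : {perm 'I_m}, forall i, M i (s i) != 0.
Proof.
move=> dM.
have [/existsP[s /forallP sM]|/existsPn nos] :=
  boolP [exists s : {perm 'I_m}, [forall i, M i (s i) != 0]]; first by exists s.
case/eqP: dM; rewrite /determinant big1 // => s _.
have /forallPn[i /negbNE Mi] := nos s.
by rewrite (bigD1 i) //= (eqP Mi) mul0r mulr0.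
Qed.
End Bordered.

(** * The weighted adjacency matrix of G_flow *)

Section FlowMatrix.
Variables (F : fieldType) (n k : nat).

Definition sel (s : 'I_k -> 'I_n) : 'M[F]_(n, k) := \matrix_(i, a) (i == s a)%:R.

(** The right copy has its own weights [L2], since the edges deleted from the flow graph all lie
    there. *)
Definition flow_mx (L L2 O : 'M[F]_n) : 'M[F]_(n + n) :=
  block_mx (1%:M - L^T) (- O) 0 (1%:M - L2).

Definition bordered_flow_mx (s y : 'I_k -> 'I_n) (L L2 O : 'M[F]_n)
    : 'M[F]_(n + n + k) :=
  block_mx (flow_mx L L2 O) (col_mx 0 (sel y)) (row_mx (sel s)^T 0) 0.

Lemma mul_sel (s y : 'I_k -> 'I_n) (A : 'M[F]_n) :
  (sel s)^T *m A *m sel y = \matrix_(a, b) A (s a) (y b).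
Proof.
apply/matrixP=> a b; rewrite !mxE (bigD1 (y b)) //= !mxE eqxx mulr1.
rewrite [X in _ + X]big1 ?addr0 => [|j /negPf jy]; last by rewrite [sel y _ _]mxE jy mulr0.
rewrite (bigD1 (s a)) //= !mxE eqxx mul1r big1 ?addr0 // => i /negPf si.
by rewrite !mxE si mul0r.
Qed.

Lemma det_bordered_flow_mx s y (L L2 O M C : 'M[F]_n) :
  (1%:M - L) *m M = 1%:M -> (1%:M - L2) *m C = 1%:M ->
  \det (bordered_flow_mx s y L L2 O) =
  \det (1%:M - L) * \det (1%:M - L2) *
    ((-1) ^+ k * \det (\matrix_(a, b) (M^T *m O *m C) (s a) (y b))).
Proof.
move=> LM LC; have ML := mulmx1C LM.
have LMT : (1%:M - L^T) *m M^T = 1%:M.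
  by rewrite -{1}(trmx1 F n) -linearB -trmx_mul ML trmx1.
(* The inverse of [flow_mx] is explicit; for [C = M] its upper right block is Sigma. *)
rewrite /bordered_flow_mx (@det_bordered _ _ _ _ (block_mx M^T (M^T *m O *m C) 0 C)).
  rewrite det_ublock -[X in X - L^T](trmx1 F n) -linearB det_tr.
  congr (_ * (_ * \det _)); rewrite -mul_sel mul_row_block !mul0mx !addr0.
  by rewrite mul_row_col mulmx0 add0r mulmxA.
rewrite mulmx_block !mul0mx !mulmx0 !addr0 add0r LMT LC !mulmxA LMT mul1mx.
by rewrite mulNmx subrr -scalar_mx_block.
Qed.

(** [g] is the part of a nonvanishing Leibniz permutation from vertex rows to vertex columns. Border
    columns are entered only from sinks, border rows lead only to sources, and the zero corner
    excludes passing from border to border. *)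
Lemma linking_of_det (D B : rel 'I_n) (W : seq 'I_n) (v : 'I_n)
    (s y : 'I_k -> 'I_n) (L L2 O : 'M[F]_n) :
  (forall i j, L i j != 0 -> D i j) ->
  (forall i j, L2 i j != 0 -> D i j && ~~ ((i \in W) && (j == v))) ->
  (forall i j, O i j != 0 -> (i == j) || B i j) ->
  \det (bordered_flow_mx s y L L2 O) != 0 ->
  exists g : 'I_n + 'I_n -> option ('I_n + 'I_n),
   [/\ forall x, (g x == None) = (x \in [set inr (y b) | b : 'I_k]),
       forall x x' z, g x = Some z -> g x' = Some z -> x = x',
       forall z, z \notin [set inl (s a) | a : 'I_k] -> exists x, g x = Some z &
       forall x z, g x = Some z -> (x == z) || flow_edge_del D B W v x z].
Proof.
move=> LD L2D OB /det_neq0_perm[p pN].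
pose g x := if split (p (lshift k (unsplit x))) is inl z then Some (split z) else None.
have gSome x z : g x = Some z -> p (lshift k (unsplit x)) = lshift k (unsplit z).
  by rewrite /g; case: split_ordP => //= z' -> [<-]; rewrite splitK.
have gNone x : g x = None -> exists b, p (lshift k (unsplit x)) = rshift (n + n) b.
  by rewrite /g; case: split_ordP => //= b -> _; exists b.
have pSome x z : p (lshift k (unsplit x)) = lshift k (unsplit z) -> g x = Some z.
  by rewrite /g => ->; rewrite (unsplitK (inl _)) unsplitK.
have pNone x b : p (lshift k (unsplit x)) = rshift (n + n) b -> g x = None.
  by rewrite /g => ->; rewrite (unsplitK (inr _)).
have colE (x : 'I_n + 'I_n) b :
    bordered_flow_mx s y L L2 O (lshift k (unsplit x)) (rshift (n + n) b) != 0 ->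
    x = inr (y b).
  rewrite block_mxEur; case: x => i /=; first by rewrite col_mxEu mxE eqxx.
  by rewrite col_mxEd mxE; case: (i =P y b) => [-> //|_]; rewrite eqxx.
have rowE (x : 'I_n + 'I_n) a :
    bordered_flow_mx s y L L2 O (rshift (n + n) a) (lshift k (unsplit x)) != 0 ->
    x = inl (s a).
  rewrite block_mxEdl; case: x => i /=; last by rewrite row_mxEr mxE eqxx.
  by rewrite row_mxEl !mxE; case: (i =P s a) => [-> //|_]; rewrite eqxx.
exists g; split.
- move=> x; apply/eqP/imsetP => [/gNone[b pb]|[b _ ->]].
    by exists b => //; apply: colE; rewrite -pb.
  have [r pr] : exists r, p r = rshift (n + n) b.
    by exists ((p^-1)%g (rshift (n + n) b)); rewrite permKV.
  have := pN r; rewrite pr; case: (split_ordP r) => [r'|a] def_r.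
    rewrite def_r -(splitK r') => /colE <-.
    by apply: (@pNone _ b); rewrite splitK -def_r.
  by rewrite def_r block_mxEdr mxE eqxx.
- move=> x x' z /gSome gx /gSome; rewrite -gx => /perm_inj/lshift_inj e.
  by rewrite -[x]unsplitK -e unsplitK.
- move=> z zS; have [r pr] : exists r, p r = lshift k (unsplit z).
    by exists ((p^-1)%g (lshift k (unsplit z))); rewrite permKV.
  have := pN r; case: (split_ordP r) => [r'|a] def_r.
    by move=> _; exists (split r'); apply: pSome; rewrite splitK -def_r.
  rewrite pr def_r => /rowE zs.
  by rewrite zs imset_f in zS.
move=> x z /gSome gx; have := pN (lshift k (unsplit x)); rewrite gx block_mxEul.
case: x z {gx} => [i|i] [j|j] /=.
- rewrite block_mxEul !mxE (inj_eq inl_inj); case: (i =P j) => //= _.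
  rewrite sub0r oppr_eq0 => /LD; rewrite /flow_edge_del /= => ->.
  by apply/negP=> /andP[/mapP[]].
- rewrite block_mxEur mxE oppr_eq0 => /OB ijB.
  by rewrite /flow_edge_del /= ijB; apply/negP=> /andP[/mapP[]].
- by rewrite block_mxEdl mxE eqxx.
rewrite block_mxEdr !mxE (inj_eq inr_inj); case: (i =P j) => //= _.
rewrite sub0r oppr_eq0 => /L2D; rewrite /flow_edge_del /=.
by rewrite (mem_map inr_inj) (inj_eq inr_inj).
Qed.

End FlowMatrix.

(** * The inverse of 1 - L and reachability *)

Section Descendants.
Variables (F : fieldType) (n : nat) (D : rel 'I_n) (L M : 'M[F]_n).
Hypothesis LD : forall i j, ~~ D i j -> L i j = 0.
Hypothesis LM : (1%:M - L) *m M = 1%:M.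

(* The row vectors supported on the vertices reachable from [a] form a subspace
   stable under the injective map [1 - L], hence also under its inverse. *)
Lemma inv_unreachable a b : ~~ connect D a b -> M a b = 0.
Proof.
move=> nab.
pose d : 'rV[F]_n := \row_i (connect D a i)%:R; pose V := diag_mx d.
have dE i : d 0 i = (connect D a i)%:R by rewrite mxE.
have stab : (V *m (1%:M - L) <= V)%MS.
  rewrite (_ : V *m _ = V *m (1%:M - L) *m V) ?submxMl //.
  rewrite mul_diag_mx mul_mx_diag; apply/matrixP=> i j; rewrite !mxE -!mulrA.
  case ai: (connect D a i); rewrite ?mul0r // !mul1r.
  case aj: (connect D a j); rewrite ?mulr1 ?mulr0 //.
  rewrite (negPf (_ : i != j)) ?LD ?subr0 //.
    by apply: contraFN aj => ij; apply: connect_trans ai (connect1 ij).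
  by apply: contraFneq aj => <-.
have uf : (1%:M - L) \in unitmx by have [] := mulmx1_unit LM.
have : (V <= V *m (1%:M - L))%MS.
  by rewrite -(mxrank_leqif_sup stab) mxrankMfree // row_free_unit.
move/(submxMr M); rewrite -mulmxA LM mulmx1 => /submxP[X VM].
have /matrixP/(_ a b) := VM; rewrite mul_mx_diag mul_diag_mx !mxE.
by rewrite connect0 (negPf nab) mul1r mulr0.
Qed.

(** In [M = 1 + L M], a nonzero term [L v u * M u v] would close a directed cycle through [v]. *)
Lemma inv_diag v : ~ des D v v -> M v v = 1.
Proof.
move=> ndv; have /matrixP/(_ v v) := LM.
rewrite mulmxBl mul1mx !mxE eqxx big1 ?subr0 // => u _.
have [vu|/LD->] := boolP (D v u); last by rewrite mul0r.
rewrite inv_unreachable ?mulr0 //; apply/negP=> uv.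
by case: ndv; exists u.
Qed.

Lemma inv_nondes v t : v != t -> ~ des D v t -> M v t = 0.
Proof.
move=> vt ndt; apply: inv_unreachable; apply/negP=> /connectP[[|u q] /=].
  by move=> _ e; rewrite e eqxx in vt.
by case/andP=> vu uq e; case: ndt; exists u; split=> //; apply/connectP; exists q.
Qed.

End Descendants.

(** Laplace expansion along the last column: its cofactors see only the columns [ts], so one vector
    [K] serves every [x] and every matrix agreeing with [A] on [ts]. *)
Lemma minor_rcons (F : comNzRingType) n (d : 'I_n) (A : 'M[F]_n) (rs ts : seq 'I_n) :
  size rs = (size ts).+1 ->
  exists K : 'I_(size rs) -> F, forall (A' : 'M[F]_n) x,
    (forall i t, t \in ts -> A' i t = A i t) ->
    minor d A' rs (rcons ts x) = \sum_(i < size rs) A' (nth d rs i) x * K i.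
Proof.
move=> sz; have lt_last : (size ts < size rs)%N by rewrite sz.
pose j0 := Ordinal lt_last.
pose Mx (A' : 'M[F]_n) x := \matrix_(i < size rs, j < size rs)
  A' (nth d rs i) (nth d (rcons ts x) j).
exists (fun i => cofactor (Mx A d) i j0) => A' x AA'.
rewrite /minor (expand_det_col _ j0); apply: eq_bigr => i _.
rewrite mxE nth_rcons ltnn eqxx; congr (_ * (_ * \det _)).
apply/matrixP=> r c; rewrite !mxE.
have cj0 : lift j0 c != j0 by rewrite eq_sym neq_lift.
have lc : (lift j0 c < size ts)%N.
  by rewrite ltn_neqAle cj0 -ltnS -sz ltn_ord.
by rewrite !nth_rcons lc AA' // mem_nth.
Qed.

(** * Generic points of Theta *)

(** A permutation matrix: row [i] outside the image of [e] points to [h i], row [e a] to border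
    column [a], and border row [a] to [s a]. *)
Lemma det_bordered_linking_neq0 (F : fieldType) n k (e s : 'I_k -> 'I_n) (h : 'I_n -> 'I_n) :
  injective e -> injective s ->
  (forall i i', i \notin codom e -> i' \notin codom e -> h i = h i' -> i = i') ->
  (forall i, i \notin codom e -> h i \notin codom s) ->
  \det (block_mx (\matrix_(i, j) ((i \notin codom e) && (h i == j))%:R)
                 (sel F e) (sel F s)^T 0) != 0.
Proof.
move=> einj sinj hinj hs.
pose c (r : 'I_(n + k)) : 'I_(n + k) :=
  match split r with
  | inl i => if [pick a | e a == i] is Some a then rshift n a else lshift k (h i)
  | inr a => lshift k (s a)
  end.
have cr a : c (rshift n a) = lshift k (s a) by rewrite /c (unsplitK (inr a)).
have cl i : (exists2 a, i = e a & c (lshift k i) = rshift n a) \/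
            (i \notin codom e /\ c (lshift k i) = lshift k (h i)).
  rewrite /c (unsplitK (inl i)); case: pickP => [a /eqP ea|ne].
    by left; exists a.
  by right; split=> //; apply/codomP=> -[a ia]; have := ne a; rewrite ia eqxx.
have cinj : injective c.
  move=> r r'; case: (split_ordP r) => x ->; case: (split_ordP r') => x' ->.
  - case: (cl x) => [[a -> ->]|[xe ->]]; case: (cl x') => [[a' -> ->]|[xe' ->]].
    + by move/rshift_inj->.
    + by move/eqP; rewrite eq_rlshift.
    + by move/eqP; rewrite eq_lrshift.
    + by move/lshift_inj/hinj->.
  - rewrite cr; case: (cl x) => [[a -> ->]|[xe ->]].
      by move/eqP; rewrite eq_rlshift.
    by move/lshift_inj=> hx; have := hs x xe; rewrite hx codom_f.
  - rewrite cr; case: (cl x') => [[a -> ->]|[xe ->]].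
      by move/eqP; rewrite eq_lrshift.
    by move/lshift_inj=> hx; have := hs x' xe; rewrite -hx codom_f.
  - by rewrite !cr => /lshift_inj/sinj->.
rewrite (_ : block_mx _ _ _ _ = \matrix_(i, j) (c i == j)%:R).
  exact: det_partial_perm_neq0.
apply/matrixP=> r r'; rewrite [RHS]mxE.
case: (split_ordP r) => x ->; case: (split_ordP r') => x' ->.
- rewrite block_mxEul mxE; case: (cl x) => [[a -> ->]|[-> ->]].
    by rewrite codom_f eq_rlshift.
  by rewrite eq_lshift.
- rewrite block_mxEur mxE; case: (cl x) => [[a -> ->]|[xe ->]].
    by rewrite eq_rshift (inj_eq einj).
  rewrite eq_lrshift; by case: eqP => // xe'; rewrite xe' codom_f in xe.
- by rewrite block_mxEdl !mxE cr eq_lshift eq_sym.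
- by rewrite block_mxEdr mxE cr eq_lrshift.
Qed.

Section Theta.
Variables (R : realType) (n : nat) (D B : rel 'I_n).
Local Notation param := (param R n).

Definition pair_line (m1 p1 m2 p2 : nat) (t : R) (x y : 'M[R]_(m1, p1) * 'M[R]_(m2, p2)) :=
  ((1 - t) *: x.1 + t *: y.1, (1 - t) *: x.2 + t *: y.2).

Lemma param_lineE t (x y : param) i :
  param_coord i (pair_line t x y) = (1 - t) * param_coord i x + t * param_coord i y.
Proof. by case: i => [[[] i] j] /=; rewrite !mxE. Qed.

Lemma pfmx_L : pfmx (@param_coord R n) (fun th => th.1).
Proof. by move=> i j; apply: (pf_coord _ (true, i, j)). Qed.

Lemma pfmx_O : pfmx (@param_coord R n) (fun th => th.2).
Proof. by move=> i j; apply: (pf_coord _ (false, i, j)). Qed.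

Lemma pf_det_reg : polyfun (@param_coord R n) (fun th => \det (1%:M - th.1)).
Proof.
apply: pf_det; apply: pfmx_add; first exact: pfmx_const.
exact/pfmx_opp/pfmx_L.
Qed.

Lemma pf_det_bordered k (s y : 'I_k -> 'I_n) : polyfun (@param_coord R n)
  (fun th => \det (bordered_flow_mx s y th.1 th.1 th.2)).
Proof.
apply: pf_det; apply: pfmx_block; try exact: pfmx_const.
apply: pfmx_block; try exact: pfmx_const.
- apply: pfmx_add; first exact: pfmx_const.
  exact/pfmx_opp/pfmx_tr/pfmx_L.
- exact/pfmx_opp/pfmx_O.
- apply: pfmx_add; first exact: pfmx_const.
  exact/pfmx_opp/pfmx_L.
Qed.

Lemma Theta_point : Theta D B (0 : 'M[R]_n, 1%:M).
Proof.
split; split=> /=.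
- by move=> i j _; rewrite mxE.
- by rewrite subr0 unitmx1.
- by rewrite trmx1.
split=> [x x0|i j /negPf ij _]; last by rewrite mxE ij.
rewrite mulmx1 mxE lt_def sumr_ge0 ?andbT => [|i _]; last by rewrite mxE -expr2 sqr_ge0.
apply: contra_neq x0 => s0; apply/rowP=> i; rewrite mxE.
have xx0 j : true -> 0 <= x 0 j * x^T j 0 by rewrite mxE -expr2 sqr_ge0.
by have /eqP := psumr_eq0P xx0 s0 (i := i) isT; rewrite mxE mulf_eq0 orbb => /eqP.
Qed.

(** [O1] may be merely semidefinite, such as a Gram matrix; strict positivity comes from [O2] and
    [0 < t]. *)
Lemma PD_line t (O1 O2 : 'M[R]_n) : 0 < t < 1 ->
  O1^T = O1 -> (forall x : 'rV_n, 0 <= (x *m O1 *m x^T) 0 0) ->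
  (forall i j, i != j -> ~~ B i j -> O1 i j = 0) ->
  PD_B B O2 -> PD_B B ((1 - t) *: O1 + t *: O2).
Proof.
move=> /andP[t0 t1] sym1 psd1 pat1 [sym2 [pd2 pat2]]; split.
  by rewrite linearD !linearZ /= sym1 sym2.
split=> [x x0|i j ij nB]; last by rewrite !mxE pat1 ?pat2 // !mulr0 addr0.
rewrite mulmxDr mulmxDl -!scalemxAr -!scalemxAl mxE ltr_wpDl //.
  by rewrite mxE mulr_ge0 // subr_ge0 ltW.
by rewrite mxE mulr_gt0 // pd2.
Qed.

Lemma Theta_common_nonzero f g :
  polyfun (@param_coord R n) f -> polyfun (@param_coord R n) g ->
  (exists th, Theta D B th /\ f th != 0) -> (exists th, Theta D B th /\ g th != 0) ->
  exists th, Theta D B th /\ f th * g th != 0.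
Proof.
move=> pf pg [x [[[xL xu] xO] fx]] [y [[[yL yu] yO] gy]].
(* Invertibility of [1 - L] need not persist along a segment, so its determinant is carried as an
   extra factor; the cone of [PD_B] is convex. *)
have pfd := pf_mul pf pf_det_reg.
have [||t [t01]] := polyfun_common_nonzero param_lineE pfd pg (x := x) (y := y) => //.
  by rewrite mulf_neq0 // -unitfE -unitmxE.
rewrite mulf_eq0 negb_or => /andP[ft dt] gt.
exists (pair_line t x y); split; last by rewrite mulf_neq0.
split; first split.
- by move=> i j nD; rewrite !mxE xL ?yL // !mulr0 addr0.
- by rewrite unitmxE unitfE.
case: xO => symx [pdx patx]; apply: PD_line => // z.
have [->|/pdx/ltW//] := eqVneq z 0.
by rewrite !mul0mx mxE.
Qed.

End Theta.

(** * Parameters realising a linking *)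

Section Generic.
Variables (R : realType) (n : nat) (D B : rel 'I_n).

Definition mx_pair_coord k (i : 'I_n * 'I_n + 'I_k * 'I_n)
    (x : 'M[R]_n * 'M[R]_(k, n)) : R :=
  match i with inl (i, j) => x.1 i j | inr (a, j) => x.2 a j end.

Lemma mx_pair_lineE k t (x y : 'M[R]_n * 'M[R]_(k, n)) i :
  mx_pair_coord i (pair_line t x y) =
  (1 - t) * mx_pair_coord i x + t * mx_pair_coord i y.
Proof. by case: i => [[i j]|[i j]] /=; rewrite !mxE. Qed.

Definition loop_supported (K : 'M[R]_n) := forall i j, K i j != 0 -> (i == j) || D i j.

(** The two determinants are nonzero at different pairs; some point of the segment between these
    serves both. The support conditions are linear, so they persist on segments. *)
Lemma common_pencil k (s y e e' : 'I_k -> 'I_n) (K1 K2 : 'M[R]_n) :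
  loop_supported K1 -> loop_supported K2 ->
  \det (block_mx K1 (sel R s) (sel R e)^T 0) != 0 ->
  \det (block_mx K2 (sel R y) (sel R e')^T 0) != 0 ->
  exists (K : 'M[R]_n) (G : 'M[R]_(k, n)),
  [/\ loop_supported K, forall a i, G a i != 0 -> (i == e a) || (i == e' a),
      forall i, K i i != 0, \det K != 0 &
      \det (block_mx K (sel R s) G 0) != 0 /\ \det (block_mx K (sel R y) G 0) != 0].
Proof.
move=> suppK1 suppK2 d1 d2.
pose X := ('M[R]_n * 'M[R]_(k, n))%type.
pose good (x : X) := loop_supported x.1 /\
  forall a i, x.2 a i != 0 -> (i == e a) || (i == e' a).
have good_line t (x z : X) : good x -> good z -> good (pair_line t x z).
  move=> [xK xG] [zK zG]; split=> i j; rewrite !mxE; apply: contraNT => nij.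
    have [/eqP-> /eqP->] : x.1 i j == 0 /\ z.1 i j == 0.
      by split; apply: contraNT nij; [apply: xK|apply: zK].
    by rewrite !mulr0 addr0.
  have [/eqP-> /eqP->] : x.2 i j == 0 /\ z.2 i j == 0.
    by split; apply: contraNT nij; [apply: xG|apply: zG].
  by rewrite !mulr0 addr0.
have pK : pfmx (@mx_pair_coord k) (fun x : X => x.1).
  by move=> i j; apply: (pf_coord _ (inl (i, j))).
have pG : pfmx (@mx_pair_coord k) (fun x : X => x.2).
  by move=> i j; apply: (pf_coord _ (inr (i, j))).
have pblock (u : 'I_k -> 'I_n) : polyfun (@mx_pair_coord k)
    (fun x : X => \det (block_mx x.1 (sel R u) x.2 0)).
  by apply: pf_det; apply: pfmx_block => //; apply: pfmx_const.
have pdiag : polyfun (@mx_pair_coord k) (fun x : X => \det x.1 * \prod_i x.1 i i).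
  by apply: pf_mul; [apply: pf_det|apply: pf_prod].
have good1 : good (K1, (sel R e)^T).
  by split=> //= a i; rewrite !mxE pnatr_eq0 eqb0 negbK => ->.
have good2 : good (K2, (sel R e')^T).
  by split=> //= a i; rewrite !mxE pnatr_eq0 eqb0 negbK => ->; rewrite orbT.
have good3 : good (1%:M, 0).
  split=> i j /=; rewrite mxE ?eqxx //.
  by rewrite pnatr_eq0 eqb0 negbK => ->.
have [t [_ t1 t2]] := polyfun_common_nonzero (@mx_pair_lineE k) (pblock s) (pblock y)
  (x := (K1, (sel R e)^T)) (y := (K2, (sel R e')^T)) d1 d2.
have := good_line t _ _ good1 good2; set z := pair_line t _ _ in t1 t2 * => goodz.
(* A second segment, towards [(1, 0)], makes the diagonal and the determinant of [K] nonzero. *)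
have [||u [_ u1 u2]] := polyfun_common_nonzero (@mx_pair_lineE k)
  (pf_mul (pblock s) (pblock y)) pdiag (x := z) (y := (1%:M, 0)).
- by rewrite mulf_neq0.
- by rewrite det1 mul1r; apply/prodf_neq0 => i _; rewrite mxE eqxx oner_neq0.
have [suppK suppG] := good_line u _ _ goodz good3.
move: u1 u2 suppK suppG; set w := pair_line u _ _.
rewrite !mulf_eq0 !negb_or => /andP[ws wy] /andP[wd wp] suppK suppG.
exists w.1, w.2; split=> // i; apply: contraNneq wp => wi.
by rewrite (bigD1 i) //= wi mul0r.
Qed.

(* Rescaling the columns of [K] to unit diagonal gives [1 - L], and the scaled
   [G^T G] gives a semidefinite matrix which is then moved into the cone. *)
Lemma Theta_of_pencil k (s y e e' : 'I_k -> 'I_n) (K : 'M[R]_n) (G : 'M[R]_(k, n)) :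
  (forall i j, B i j = B j i) ->
  (forall a, (e a == e' a) || B (e a) (e' a)) ->
  loop_supported K -> (forall a i, G a i != 0 -> (i == e a) || (i == e' a)) ->
  (forall i, K i i != 0) -> \det K != 0 ->
  \det (block_mx K (sel R s) G 0) != 0 -> \det (block_mx K (sel R y) G 0) != 0 ->
  exists th : param R n, Theta D B th /\ \det (bordered_flow_mx s y th.1 th.1 th.2) != 0.
Proof.
move=> symB eB suppK suppG diagK detK ds dy.
pose d : 'rV[R]_n := \row_i (K i i)^-1; pose d' : 'rV[R]_n := \row_i K i i.
have dd' : diag_mx d *m diag_mx d' = 1%:M.
  apply/matrixP=> i j; rewrite mul_diag_mx !mxE.
  by case: eqP => [->|]; rewrite ?mulr0 // mulr1n mulVf.
have uK : K \in unitmx by rewrite unitmxE unitfE.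
pose L := 1%:M - K *m diag_mx d; pose M := diag_mx d' *m invmx K.
have subL : 1%:M - L = K *m diag_mx d by rewrite subKr.
have LM : (1%:M - L) *m M = 1%:M.
  by rewrite subL -mulmxA (mulmxA (diag_mx d)) dd' mul1mx mulmxV.
have uL : (1%:M - L) \in unitmx by have [] := mulmx1_unit LM.
have suppL i j : ~~ D i j -> L i j = 0.
  move=> nD; rewrite /L mul_mx_diag !mxE; have [<-|ij] := eqVneq i j.
    by rewrite divff ?subrr.
  have [->|/suppK] := eqVneq (K i j) 0; first by rewrite mul0r subrr.
  by rewrite (negPf ij) (negPf nD).
pose H := G *m diag_mx d; pose O := H^T *m H.
have HM : H *m M = G *m invmx K by rewrite /H -mulmxA (mulmxA (diag_mx d)) dd' mul1mx.
have symO : O^T = O by rewrite trmx_mul trmxK.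
have psdO (x : 'rV_n) : 0 <= (x *m O *m x^T) 0 0.
  rewrite mulmxA -mulmxA -[H in H *m x^T]trmxK -trmx_mul mxE sumr_ge0 // => a _.
  by rewrite [(_^T) _ _]mxE -expr2 sqr_ge0.
have patO i j : i != j -> ~~ B i j -> O i j = 0.
  (* A nonzero term needs [i] and [j] among [e a] and [e' a], hence equal or joined by a bidirected
     edge. *)
  move=> ij nB; rewrite mxE big1 // => a _; rewrite mxE /H mul_mx_diag !mxE.
  have [->|/suppG Gi] := eqVneq (G a i) 0; first by rewrite !mul0r.
  have [->|/suppG Gj] := eqVneq (G a j) 0; first by rewrite mul0r mulr0.
  move: (eB a) ij nB.
  case/orP: Gi => /eqP->; case/orP: Gj => /eqP->; rewrite ?eqxx // 1?[_ e' _ == _]eq_sym.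
    by case: eqP => //= _ ->.
  by rewrite (symB (e' a)) eq_sym; case: eqP => //= _ ->.
have detO : \det (bordered_flow_mx s y L L O) != 0.
  rewrite (det_bordered_flow_mx _ _ _ LM LM) !mulf_neq0 ?signr_eq0 //;
    rewrite -?unitfE -?unitmxE //.
  rewrite -mul_sel.
  (* Sigma is [X^T X] with [X = G K^-1], so its minor is a product of two determinants, each a
     bordered determinant of [K] up to a nonzero factor. *)
  have -> : M^T *m O *m M = (G *m invmx K)^T *m (G *m invmx K).
    by rewrite -HM /O (trmx_mul H M) !mulmxA.
  have -> (X : 'M_(k, n)) : (sel R s)^T *m (X^T *m X) *m sel R y =
      (X *m sel R s)^T *m (X *m sel R y) by rewrite trmx_mul !mulmxA.
  rewrite unitmxE unitfE det_mulmx det_tr.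
  have KV : K *m invmx K = 1%:M by apply: mulmxV.
  move: ds dy; rewrite !(det_bordered _ _ KV) !mulf_eq0 !negb_or.
  by case/and3P=> _ _ ? /and3P[_ _ ?]; apply/andP.
(* [O] moves towards the identity with [L] fixed; the determinant is nonzero at 0, hence at some [t]
   between 0 and 1. *)
have [p [pE p0 _]] := polyfun_line (@param_lineE R n) (pf_det_bordered R s y)
  (L, O) (L, 1%:M).
have /poly_nonroot01[t [t01 pt]] : p != 0.
  by apply: contraNneq detO => pz; move: p0; rewrite pz horner0 => <-.
exists (pair_line t (L, O) (L, 1%:M)); split; last by rewrite pE.
have eL : (1 - t) *: L + t *: L = L by rewrite -scalerDl subrK scale1r.
split; first by split; rewrite /= eL.
by apply: PD_line => //; have [] := Theta_point R D B.
Qed.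

(** The left part of the linking gives [K1], the right part [K2], and the crossings border both to
    permutation matrices; a common pencil then yields a point of [Theta]. *)
Lemma bordered_neq0_of_linking k (s y : 'I_k -> 'I_n)
    (g : 'I_n + 'I_n -> option ('I_n + 'I_n)) :
  mixed_graph D B -> injective s -> injective y ->
  (forall x, (x \in [set inr (y b) | b : 'I_k]) = (g x == None)) ->
  (forall x x' z, g x = Some z -> g x' = Some z -> x = x') ->
  (forall z, z \notin [set inl (s a) | a : 'I_k] -> exists x, g x = Some z) ->
  (forall x z, g x = Some z -> z \notin [set inl (s a) | a : 'I_k]) ->
  (forall x z, g x = Some z -> (x == z) || flow_edge D B x z) ->
  exists th : param R n,
    Theta D B th /\ \det (bordered_flow_mx s y th.1 th.1 th.2) != 0.
Proof.
move=> [_ [_ symB]] sinj yinj gN ginj gsurj gS gE.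
(* [P] is the set of sources of the crossings [i -> (q i)']; [hl] and [hr] are the
   restrictions of [g] to the left and right copies. *)
pose P := [set i | if g (inl i) is Some (inr _) then true else false].
pose hl i := if g (inl i) is Some (inl j) then j else i.
pose hr i := if g (inr i) is Some (inr j) then j else i.
pose q i := if g (inl i) is Some (inr j) then j else i.
have glE i : i \notin P -> g (inl i) = Some (inl (hl i)).
  rewrite inE /hl; case gi: (g (inl i)) => [[]|] // _.
  by have := gN (inl i); rewrite gi eqxx => /imsetP[].
have gqE i : i \in P -> g (inl i) = Some (inr (q i)).
  by rewrite inE /q; case: (g (inl i)) => [[]|].
have grE i : i \notin codom y -> g (inr i) = Some (inr (hr i)).
  move=> iy; rewrite /hr; case gi: (g (inr i)) => [[j|j]|] //.
    by have := gE _ _ gi.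
  have := gN (inr i); rewrite gi eqxx => /imsetP[b _ [ib]].
  by rewrite ib codom_f in iy.
have hlS i : i \notin P -> hl i \notin codom s.
  move=> /glE/gS; apply: contraNN => /codomP[a ->]; exact: imset_f.
have hlinj : {in ~: P &, injective hl}.
  move=> i i'; rewrite !in_setC => /glE gi /glE gi' hii'.
  by rewrite hii' in gi; case: (ginj _ _ _ gi gi').
(* [hl] maps the complement of [P] bijectively onto the complement of the image of [s], so there are
   exactly [k] crossings. *)
have cP : #|P| = k.
  have imh : hl @: (~: P) = ~: [set s a | a : 'I_k].
    apply/setP=> j; rewrite inE; apply/imsetP/negP => [[i iP ->] /imsetP[a _ ja]|js].
      by have := hlS i; rewrite -in_setC => /(_ iP); rewrite ja codom_f.
    have [|[i|i] gi] := gsurj (inl j); last by have := gE _ _ gi.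
      by apply/imsetP=> -[a _ [ja]]; apply: js; apply/imsetP; exists a.
    by exists i; rewrite ?inE /hl gi.
  apply/eqP; rewrite -(eqn_add2r #|~: P|) cardsC -(card_in_imset hlinj) imh.
  by rewrite -{1}(card_ord k) -(card_imset _ sinj) cardsC.
pose e (a : 'I_k) := enum_val (cast_ord (esym cP) a).
have eP a : e a \in P by apply: enum_valP.
have einj : injective e by move=> a a' /enum_val_inj/cast_ord_inj.
have codom_e i : (i \in codom e) = (i \in P).
  apply/codomP/idP => [[a ->] //|iP]; exists (cast_ord cP (enum_rank_in iP i)).
  by rewrite /e cast_ordK enum_rankK_in.
(* The left copy traverses directed edges backwards, hence the transpose. *)
pose K1 : 'M[R]_n := (\matrix_(i, j) ((i \notin codom e) && (hl i == j))%:R)^T.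
pose K2 : 'M[R]_n := \matrix_(i, j) ((i \notin codom y) && (hr i == j))%:R.
have suppK1 : loop_supported K1.
  move=> j i; rewrite !mxE pnatr_eq0 eqb0 negbK codom_e => /andP[/glE/gE gi /eqP <-].
  by move: gi; rewrite (inj_eq inl_inj) /= eq_sym.
have suppK2 : loop_supported K2.
  move=> i j; rewrite !mxE pnatr_eq0 eqb0 negbK => /andP[/grE/gE gi /eqP <-].
  by move: gi; rewrite (inj_eq inr_inj).
have det1 : \det (block_mx K1 (sel R s) (sel R e)^T 0) != 0.
  rewrite -det_tr tr_block_mx trmxK trmx0 trmxK.
  apply: det_bordered_linking_neq0 => // [i i'|i]; rewrite !codom_e.
    by move=> iP i'P; apply: hlinj; rewrite inE.
  exact: hlS.
have qinj : injective (q \o e).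
  move=> a a' qa; apply: einj; have := gqE _ (eP a).
  by rewrite -[q _]/((q \o e) a) qa => /ginj/(_ (gqE _ (eP a')))[].
have det2 : \det (block_mx K2 (sel R y) (sel R (q \o e))^T 0) != 0.
  apply: det_bordered_linking_neq0 => // [i i' /grE gi /grE gi' hii'|i /grE gi].
    by rewrite hii' in gi; case: (ginj _ _ _ gi gi').
  (* [g] is injective, so [hr] cannot reach the end of a crossing. *)
  apply/codomP=> -[a hq]; rewrite hq in gi.
  by have := ginj _ _ _ gi (gqE _ (eP a)).
have [K [G [suppK suppG diagK detK [ds dy]]]] := common_pencil suppK1 suppK2 det1 det2.
apply: (Theta_of_pencil _ _ suppK suppG diagK detK ds dy) => // a.
by have /gE := gqE _ (eP a).
Qed.

End Generic.

(** * Generic properties and the determinantal identity *)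

Section Generically.
Variables (R : realType) (n : nat) (D B : rel 'I_n).

(** Nonvanishing of one polynomial function, instead of avoidance of an algebraic set: conjunctions
    become products. *)
Definition generically (P : param R n -> Prop) :=
  exists q, [/\ polyfun (@param_coord R n) q, exists th, Theta D B th /\ q th != 0 &
    forall th, Theta D B th -> q th != 0 -> P th].

Lemma generically_algebraic (P : param R n -> Prop) :
  generically P <->
  exists A, proper_algebraic_subset D B A /\
    forall th, Theta D B th -> ~ A th -> P th.
Proof.
split=> [[q [pq [th [thT qth]] qP]]|[A [[[m [ps [pps Aps]]] [th [thT nA]]] AP]]].
  exists (fun x => Theta D B x /\ q x = 0); split; last first.
    by move=> x xT nA; apply: qP => //; apply/eqP=> qx; apply: nA.
  split; last by exists th; split=> // -[_ /eqP]; apply/negP.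
  exists 1%N, (fun=> q); split=> // x; split=> [[? ?]|[? h]]; split=> //.
  exact: (h ord0).
have [/existsP[j pj]|/existsPn p0] := boolP [exists j, ps j th != 0]; last first.
  by case: nA; apply/Aps; split=> // j; apply/eqP/negbNE.
exists (ps j); split=> // [|x xT px]; first by exists th.
by apply: AP => // /Aps[_ /(_ j)/eqP]; apply/negP.
Qed.

Lemma generically_imp (P Q : param R n -> Prop) :
  (forall th, Theta D B th -> P th -> Q th) -> generically P -> generically Q.
Proof. by move=> PQ [q [pq qT qP]]; exists q; split=> // th thT /(qP _ thT)/PQ; apply. Qed.

Lemma generically_and (P Q : param R n -> Prop) :
  generically P -> generically Q -> generically (fun th => P th /\ Q th).
Proof.
move=> [f [pf fT fP]] [g [pg gT gQ]]; exists (fun th => f th * g th); split.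
- exact: pf_mul.
- exact: Theta_common_nonzero.
- by move=> th thT; rewrite mulf_eq0 negb_or => /andP[? ?]; split; [apply: fP|apply: gQ].
Qed.

Lemma generically_true (P : param R n -> Prop) :
  (forall th, Theta D B th -> P th) -> generically P.
Proof.
move=> allP; exists (fun=> 1); split=> [|| th thT _]; first exact: pf_const.
  by exists (0, 1%:M); rewrite oner_neq0; split=> //; apply: Theta_point.
exact: allP.
Qed.

Lemma generically_all (ws : seq 'I_n) (P : 'I_n -> param R n -> Prop) :
  (forall w, w \in ws -> generically (P w)) ->
  generically (fun th => forall w, w \in ws -> P w th).
Proof.
elim: ws => [|w ws IHws] Pws; first exact: generically_true.
have /generically_and/(_ (IHws _)) : generically (P w) by apply: Pws; rewrite mem_head.
case=> [w' w'ws|q [pq qT qP]]; first by apply: Pws; rewrite inE w'ws orbT.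
exists q; split=> // th thT qth w'; have [Pw Pws'] := qP th thT qth.
by rewrite inE => /predU1P[->|/Pws'].
Qed.

End Generically.

(** * The linear relation between minors of Sigma *)

Section Identity.
Variables (R : realType) (n : nat) (D B : rel 'I_n).
Variables (v : 'I_n) (W ts rs : seq 'I_n).
Hypothesis sz : size rs = (size ts).+1.

Local Notation srcs := (fun a : 'I_(size rs) => nth v rs a).
Local Notation snks x := (fun b : 'I_(size rs) => nth v (rcons ts x) b).

Lemma phi_inv (th : param R n) : Theta D B th ->
  (1%:M - th.1) *m invmx (1%:M - th.1) = 1%:M.
Proof. by move=> [[_ ?] _]; apply: mulmxV. Qed.

Lemma bordered_minor (th : param R n) x : Theta D B th ->
  (\det (bordered_flow_mx srcs (snks x) th.1 th.1 th.2) != 0) =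
  (minor v (phiG th) rs (rcons ts x) != 0).
Proof.
move=> thT; have [[_ uL] _] := thT.
rewrite (det_bordered_flow_mx _ _ _ (phi_inv thT) (phi_inv thT)).
rewrite !mulf_eq0 signr_eq0 /= -[_ == 0]negbK -unitfE -unitmxE uL /=.
by [].
Qed.

Hypothesis uniqW : uniq W.
Hypothesis WD : forall w, w \in W -> D w v.
Hypothesis ndv : ~ des D v v.
Hypothesis ndT : forall t, t \in ts -> v != t /\ ~ des D v t.

(* [1 - L2] is the matrix of the graph without the edges from [W] to [v]; since
   no walk leads from [v] to [v] or [ts], on the columns [v :: ts] its inverse
   agrees with [M] times [1] minus the deleted part [L']. *)
Lemma minor_relation :
  (forall g : 'I_n + 'I_n -> option ('I_n + 'I_n),
    ~ [/\ forall x, (g x == None) = (x \in [set inr (snks v b) | b : 'I_(size rs)]),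
       forall x x' z, g x = Some z -> g x' = Some z -> x = x',
       forall z, z \notin [set inl (srcs a) | a : 'I_(size rs)] -> exists x, g x = Some z &
       forall x z, g x = Some z -> (x == z) || flow_edge_del D B W v x z]) ->
  forall th : param R n, Theta D B th ->
  minor v (phiG th) rs (rcons ts v) =
  \sum_(w <- W) th.1 w v * minor v (phiG th) rs (rcons ts w).
Proof.
move=> nog th thT; have [[LD _] [_ [_ OB]]] := thT.
set L := th.1 in LD *; set O := th.2 in OB *.
have LM := phi_inv thT; rewrite -/L in LM.
set M := invmx (1%:M - L) in LM.
pose L' : 'M[R]_n := \matrix_(i, j) if (i \in W) && (j == v) then L i j else 0.
(* The Neumann series for the inverse of [1 - L + L'] stops here since [L' M L' = 0]: a walk from
   [v] to a vertex of [W] would close a cycle at [v]. *)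
pose C := M - M *m L' *m M.
have L'0 (A : 'M[R]_n) i j : (forall w, w \in W -> A i w = 0) -> (A *m L') i j = 0.
  move=> A0; rewrite mxE big1 // => w _; rewrite mxE.
  by case: ifP => [/andP[/A0-> _]|_]; rewrite ?mul0r ?mulr0.
have Mvw w : w \in W -> M v w = 0.
  move=> /WD wv; apply: (inv_unreachable LD LM); apply/negP=> /connectP[[|u q] /=].
    by move=> _ e; apply: ndv; exists v; rewrite -{1}e wv connect0.
  case/andP=> vu uq e; apply: ndv; exists u; split=> //.
  by apply: connect_trans (connect1 wv); apply/connectP; exists q.
have ML'v j : (M *m L') v j = 0 by apply: L'0.
have L'v (A : 'M[R]_n) i j : (L' *m A) i j = L' i v * A v j.
  rewrite mxE (bigD1 v) //= big1 ?addr0 // => u /negPf uv.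
  by rewrite mxE uv andbF mul0r.
have L'ML' : L' *m M *m L' = 0.
  by apply/matrixP=> i j; rewrite -mulmxA L'v ML'v mulr0 mxE.
have LC : (1%:M - (L - L')) *m C = 1%:M.
  rewrite opprB addrCA addrC mulmxDl /C mulmxBr -mulmxA mulmxA -!mulmxA.
  rewrite (mulmxA _ M) LM mul1mx mulmxBr.
  rewrite (mulmxA L' M (L' *m M)) (mulmxA (L' *m M)) L'ML' mul0mx subr0.
  by rewrite subrK.
have L2D i j : (L - L') i j != 0 -> D i j && ~~ ((i \in W) && (j == v)).
  rewrite !mxE; case: ifP => [_|_]; first by rewrite subrr eqxx.
  by rewrite subr0 andbT; apply: contraNT => /LD->.
have LD' i j : L i j != 0 -> D i j by apply: contraNT => /LD->.
have OB' i j : O i j != 0 -> (i == j) || B i j.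
  by apply: contraNT; rewrite negb_or => /andP[ij nB]; rewrite OB.
(* A nonzero minor would give a linking in the deleted graph. The left factor keeps all edges; only
   [C] sees the deletion. *)
have minor0 : minor v (M^T *m O *m C) rs (rcons ts v) = 0.
  apply/eqP/negPn/negP=> mn0.
  have [|g] := @linking_of_det _ _ _ D B W v srcs (snks v) L (L - L') O LD' L2D OB'.
    rewrite (det_bordered_flow_mx _ _ _ LM LC) !mulf_neq0 ?signr_eq0 //.
      by rewrite -unitfE -unitmxE; have [] := mulmx1_unit LM.
    by rewrite -unitfE -unitmxE; have [] := mulmx1_unit LC.
  exact: nog.
have SigC : M^T *m O *m C = phiG th - phiG th *m L' *m M.
  by rewrite /C mulmxBr /phiG -/L -/M -/O !mulmxA.
have [K minorK] := minor_rcons v (phiG th) sz.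
(* On the columns [ts] the correction vanishes because [M v t = 0], so both matrices share the
   cofactors [K]. *)
have eK : \sum_(i < size rs) (M^T *m O *m C) (nth v rs i) v * K i = 0.
  rewrite -minorK // => i t /ndT[vt nt].
  rewrite SigC -mulmxA mxE [X in _ + X]mxE [X in _ - X](_ : _ = 0) ?subr0 //.
  rewrite mxE big1 // => u _; rewrite L'v (inv_nondes LD LM vt nt).
  by rewrite !mulr0.
apply/eqP; rewrite -subr_eq0 -[X in _ == X]eK; apply/eqP.
rewrite minorK //.
under [X in _ - X]eq_bigr do rewrite minorK // mulr_sumr.
rewrite exchange_big -sumrB; apply: eq_bigr => i _ /=.
under eq_bigr do rewrite mulrA; rewrite -mulr_suml -mulrBl; congr (_ * _).
(* As [M v v = 1], the correction in column [v] is the sum of the columns [w] of Sigma weighted by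
   [L w v]. *)
rewrite SigC -[_ *m L' *m M]mulmxA [RHS]mxE [X in _ = _ + X]mxE; congr (_ - _).
rewrite [RHS]mxE; under [RHS]eq_bigr do rewrite L'v (inv_diag LD LM ndv) mulr1 [L' _ _]mxE eqxx andbT.
rewrite big_uniq //= big_mkcond; apply: eq_bigr => w _.
by case: ifP; rewrite ?mulr0 // mulrC.
Qed.

End Identity.

(** * Indexing by sets and rational combinations of minors *)

Lemma imset_nth (n : nat) (U : finType) (h : 'I_n -> U) (d : 'I_n) (r : seq 'I_n)
    (A : {set 'I_n}) m :
  size r = m -> r =i A -> [set h (nth d r a) | a : 'I_m] = h @: A.
Proof.
move=> szr rA; apply/setP=> x; apply/imsetP/imsetP => [[a _ ->]|[i iA ->]].
  by exists (nth d r a); rewrite // -rA mem_nth ?szr.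
have ir : (index i r < m)%N by rewrite -szr index_mem rA.
by exists (Ordinal ir); rewrite //= nth_index // rA.
Qed.

Lemma pf_minor (R : realType) n (d : 'I_n) rs cs :
  polyfun (@mx_coord R n) (fun S => minor d S rs cs).
Proof.
apply: pf_det => i j; apply: pf_ext (pf_coord _ (nth d rs i, nth d cs j)) => S.
by rewrite mxE.
Qed.

(** Fractions are added over the product of their denominators, which is generically nonzero because
    each factor is. *)
Lemma rational_sum (R : realType) n (D B : rel 'I_n) v (ws : seq 'I_n)
    (m : 'I_n -> 'M[R]_n -> R) :
  (forall w, polyfun (@mx_coord R n) (m w)) ->
  (forall w, w \in ws -> rationally_identifiable R D B w v) ->
  exists P Q, [/\ polyfun (@mx_coord R n) P, polyfun (@mx_coord R n) Q &
    generically D B (fun th => Q (phiG th) != 0 /\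
      P (phiG th) / Q (phiG th) = \sum_(w <- ws) th.1 w v * m w (phiG th))].
Proof.
move=> pm; elim: ws => [|w ws IHws] ri.
  exists (fun=> 0), (fun=> 1); split; try exact: pf_const.
  by apply: generically_true => th _; rewrite oner_neq0 mul0r big_nil.
have [|P [Q [pP pQ gPQ]]] := IHws.
  by move=> w' w'ws; apply: ri; rewrite inE w'ws orbT.
have [P1 [Q1 [pP1 [pQ1 /generically_algebraic gPQ1]]]] := ri w (mem_head _ _).
exists (fun x => P1 x * m w x * Q x + P x * Q1 x), (fun x => Q1 x * Q x); split.
- by do !apply: pf_add => //; do !apply: pf_mul => //.
- exact: pf_mul.
apply: generically_imp (generically_and gPQ1 gPQ) => th _ [[Q10 eP1] [Q0 ePQ]].
by rewrite mulf_neq0 // big_cons -ePQ -eP1; split=> //; field; rewrite Q0 Q10.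
Qed.

Theorem theorem3p8 (R : realType) (n : nat) (D B : rel 'I_n)
  (v w0 : 'I_n) (ws : seq 'I_n) (S T : {set 'I_n}) (k : nat) :
  mixed_graph D B ->
  D w0 v ->
  uniq (w0 :: ws) ->
  (forall w, w \in ws -> D w v) ->
  v \notin T -> w0 \notin T ->
  #|S| = k -> #|T| + 1 = k ->
  (* (a) *) (forall x, x \in v |: T -> ~ des D v x) ->
  (* (b) *) maxflow_eq R (flow_edge D B) (inl @: S) (inr @: (w0 |: T)) k ->
  (* (c) *) maxflow_lt R (flow_edge_del D B (w0 :: ws) v)
               (inl @: S) (inr @: (v |: T)) k ->
  let Sig th := phiG th in
  let rows := enum S in
  let cols x := rcons (enum T) x in
  let formula_holds :=
    exists A, proper_algebraic_subset D B A /\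
      forall th : param R n, Theta D B th -> ~ A th ->
        minor v (Sig th) rows (cols w0) != 0 /\
        th.1 w0 v =
          (minor v (Sig th) rows (cols v)
           - \sum_(w <- ws) th.1 w v * minor v (Sig th) rows (cols w))
          / minor v (Sig th) rows (cols w0) in
  ((forall w, w \in ws -> generically_identifiable R D B w v) ->
     generically_identifiable R D B w0 v /\ formula_holds)
  /\
  ((forall w, w \in ws -> rationally_identifiable R D B w v) ->
     rationally_identifiable R D B w0 v /\ formula_holds).
Proof.
move=> mixG w0v uniqW wsv vT w0T cS cT ndes [[f [flowf valf]] _] ltk Sig rows cols formula.
have {}cT : #|T|.+1 = k by rewrite -cT -[RHS]/(#|T| + 1)%N addn1.
have szr : size rows = k by rewrite -cardE.
have szc x : size (cols x) = size rows by rewrite size_rcons -cardE cT szr.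
have sz : size rows = (size (enum T)).+1 by rewrite -cardE cT.
have colsE x : cols x =i x |: T by move=> y; rewrite mem_rcons !inE mem_enum.
have dis (X Y : {set 'I_n}) : [disjoint inl @: X & inr @: Y].
  by apply/pred0P=> x; apply/andP=> -[/imsetP[i _ ->] /imsetP[]].
have srcE : [set inl (nth v rows a) | a : 'I_(size rows)] = inl @: S :> {set 'I_n + 'I_n}.
  by apply: imset_nth => // i; rewrite mem_enum.
have snkE x : [set inr (nth v (cols x) b) | b : 'I_(size rows)] =
    inr @: (x |: T) :> {set 'I_n + 'I_n}.
  exact: imset_nth.
have cSnk x : x \notin T -> #|inr @: (x |: T) : {set 'I_n + 'I_n}| = k.
  by move=> xT; rewrite card_imset ?cardsU1 ?xT //; apply: inr_inj.
have relation (th : param R n) : Theta D B th ->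
    minor v (Sig th) rows (cols v) =
    \sum_(w <- w0 :: ws) th.1 w v * minor v (Sig th) rows (cols w).
  apply: minor_relation => //.
  - by move=> w; rewrite inE => /predU1P[->|/wsv].
  - by apply: ndes; rewrite setU11.
  - move=> t; rewrite mem_enum => tT; split; last by apply: ndes; rewrite setU1r.
    by apply: contraNneq vT => ->.
  (* Such a linking would be a flow of value [k] in the deleted graph, against (c). *)
  move=> g [gN ginj gsurj gE]; rewrite srcE in gsurj.
  have [||||h [flowh valh]] := @flow_of_linking R _
    (flow_edge_del D B (w0 :: ws) v) _ _ (dis S (v |: T)) g => //.
    by move=> x; rewrite gN snkE.
  by have := ltk h flowh; rewrite valh cSnk // ltxx.
have generic0 : generically D B (fun th : param R n =>
    minor v (Sig th) rows (cols w0) != 0).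
  have [||g [gN ginj gsurj gS gE]] := linking_of_flow (dis S (w0 |: T)) _ flowf.
  - by rewrite cSnk // card_imset //; apply: inl_inj.
  - by rewrite cSnk.
  have nth_inj (r : seq 'I_n) : uniq r -> size r = size rows ->
      injective (fun a : 'I_(size rows) => nth v r a).
    move=> ur szr' a a' /eqP; rewrite nth_uniq ?szr' // => /eqP; exact: val_inj.
  rewrite -srcE -(snkE w0) in gN gsurj gS.
  have [||th [thT bth]] := bordered_neq0_of_linking R mixG _ _ gN ginj gsurj gS gE.
  - by apply: nth_inj => //; apply: enum_uniq.
  - by apply: nth_inj; rewrite // rcons_uniq mem_enum w0T enum_uniq.
  (* The minor involves an inverse matrix; the bordered determinant is polynomial in the parameters
     and has the same zeros on [Theta]. *)
  exists (fun th => \det (bordered_flow_mx (fun a : 'I_(size rows) => nth v rows a)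
     (fun b : 'I_(size rows) => nth v (cols w0) b) th.1 th.1 th.2)); split.
  - exact: pf_det_bordered.
  - by exists th.
  - by move=> {bth}th {}thT; rewrite (bordered_minor _ _ _ _ thT).
have solve (th : param R n) : Theta D B th -> minor v (Sig th) rows (cols w0) != 0 ->
    th.1 w0 v = (minor v (Sig th) rows (cols v)
       - \sum_(w <- ws) th.1 w v * minor v (Sig th) rows (cols w))
      / minor v (Sig th) rows (cols w0).
  by move=> thT m0; rewrite relation // big_cons addrK mulfK.
have formulaP : formula.
  apply/generically_algebraic; apply: generically_imp generic0 => th thT m0.
  by split=> //; apply: solve.
split=> ids; split=> //.
  apply/generically_algebraic.
  have gws w : w \in ws -> generically D B (fun th : param R n => forall th',
      Theta D B th' -> phiG th' = phiG th -> th'.1 w v = th.1 w v).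
    by move/ids=> /generically_algebraic.
  apply: generically_imp (generically_and generic0 (generically_all gws)).
  move=> th thT [m0 same] th' th'T eqphi.
  (* The right side of the formula involves only Sigma and the coefficients of the edges from [ws],
     which agree for both parameters. *)
  have eqSig : Sig th' = Sig th by [].
  rewrite (solve th thT m0) (solve th') ?eqSig //.
  congr ((_ - _) / _); apply: eq_big_seq => w wws.
  by rewrite (same w wws th').
have [P [Q [pP pQ gPQ]]] := rational_sum (fun w => pf_minor R v rows (cols w)) ids.
(* The formula with the sum replaced by [P / Q], cleared of the inner denominator. *)
exists (fun x => minor v x rows (cols v) * Q x - P x),
       (fun x => Q x * minor v x rows (cols w0)).
split; first by apply: pf_add; [apply: pf_mul => //; apply: pf_minor|apply: pf_opp].
split; first by apply: pf_mul => //; apply: pf_minor.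
apply/generically_algebraic; apply: generically_imp (generically_and generic0 gPQ).
move=> th thT [m0 [Q0 ePQ]]; rewrite mulf_neq0 //; split=> //.
rewrite (solve th thT m0) -ePQ -/(Sig th).
rewrite -{2}[minor v (Sig th) rows (cols v)](mulfK Q0) -mulrBl invfM.
by rewrite !mulrA.
Qed.
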